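(* Let $(M,H)$ be a Hamilton space with Hamiltonian vector field $\rho_H$. If $\widetilde{X}\in\mathcal{X}(M)$ is an invariant vector field for $H$, i.e. $\widetilde{X}^{C*}(H)=0$, then its complete lift $\widetilde{X}^{C*}$ is an exact infinitesimal Noether symmetry of $H$, and consequently $\widetilde{X}$ is a natural infinitesimal symmetry. Moreover, the function $\theta(\widetilde{X}^{C*})=p_i\widetilde{X}^i$ is a conservation law for $H$.
   Context: Hamilton space: $M$ is a smooth $n$-dimensional manifold and $H:T^{*}M\to\mathbb{R}$ is smooth on $T^{*}M\setminus\{0\}$ (zero section removed), continuous on the zero section, with $g^{ij}=\frac{\partial^2H}{\partial p_i\partial p_j}$ of rank $n$ and constant signature on $T^{*}M\setminus\{0\}$, in induced coordinates $(x^i,p_i)$. All structures are considered on $T^{*}M\setminus\{0\}$. $\theta=p_i\,dx^i$ is the Liouville 1-form and $\omega=d\theta=dp_i\wedge dx^i$ the canonical symplectic form. The Hamiltonian vector field $\rho_H=\frac{\partial H}{\partial p_i}\frac{\partial}{\partial x^i}-\frac{\partial H}{\partial x^i}\frac{\partial}{\partial p_i}$ is determined by $i_{\rho_H}\omega=-dH$. For $\widetilde{X}=\widetilde{X}^i(x)\frac{\partial}{\partial x^i}\in\mathcal{X}(M)$, its complete lift to $T^{*}M$ is $\widetilde{X}^{C*}=\widetilde{X}^i\frac{\partial}{\partial x^i}-p_j\frac{\partial\widetilde{X}^j}{\partial x^i}\frac{\partial}{\partial p_i}$. Infinitesimal Noether symmetry of $H$: a vector field $X$ on $T^{*}M\setminus\{0\}$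 with $\mathcal{L}_X\omega=0$ and $\mathcal{L}_XH=0$; it is exact if the 1-form $\mathcal{L}_X\theta$ is exact. Natural infinitesimal symmetry: a vector field $\widetilde{X}\in\mathcal{X}(M)$ with $[\rho_H,\widetilde{X}^{C*}]=0$. Conservation law for $H$: a function $f\in C^\infty(T^{*}M\setminus\{0\})$ with $\rho_H(f)=0$. *)

(* Defs.v *)
From HB Require Import structures.
From mathcomp Require Import all_boot all_order all_algebra.
From mathcomp Require Import all_classical all_reals all_analysis.

Set Implicit Arguments.
Unset Strict Implicit.
Unset Printing Implicit Defensive.

Import Order.TTheory GRing.Theory Num.Theory.
Import numFieldNormedType.Exports.

Local Open Scope classical_set_scope.
Local Open Scope ring_scope.

Definition pd (R : realType) (m : nat) (V : normedModType R) (A : 'I_m)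
    (f : 'rV[R]_m -> V) : 'rV[R]_m -> V :=
  fun y => 'D_(delta_mx 0 A) f y.

(* Meaningful for open U.  As 'rV[R]_m is finite-dimensional, continuity of the
   derivative amounts to continuity of all directional derivatives. *)
Fixpoint Ck (R : realType) (m : nat) (V : normedModType R) (k : nat)
    (U : set 'rV[R]_m) (f : 'rV[R]_m -> V) : Prop :=
  match k with
  | 0%N => forall y, U y -> {for y, continuous f}
  | k'.+1 => (forall y, U y -> differentiable f y) /\
             (forall v : 'rV[R]_m, Ck k' U (fun y => 'D_v f y))
  end.

Definition smooth_on (R : realType) (m : nat) (V : normedModType R)
    (U : set 'rV[R]_m) (f : 'rV[R]_m -> V) : Prop :=
  forall k, Ck k U f.

(* Tensor calculus only refers to charts, so it is developed for sets equipped
   with a family of charts; the value of a chart off its domain is junk. *)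
Record charted (R : realType) (m : nat) := Charted {
  carrier :> Type;
  chart : Type;
  cdom : chart -> set carrier;
  ccoord : chart -> carrier -> 'rV[R]_m }.

Arguments cdom {R m} _ _.
Arguments ccoord {R m} _ _ _.

Section Calculus.
Variables (R : realType) (m : nat) (N : charted R m).
Implicit Types (a b : chart N) (q : N).

Definition img a : set 'rV[R]_m := ccoord N a @` cdom N a.

(* f o (ccoord a)^-1, extended by 0 outside img a *)
Definition rep (V : normedModType R) a (f : N -> V) : 'rV[R]_m -> V :=
  fun y => xget 0 (f @` (cdom N a `&` ccoord N a @^-1` [set y])).

Definition trans a b : 'rV[R]_m -> 'rV[R]_m := rep a (ccoord N b).

Definition smooth_fun (f : N -> R) : Prop :=
  forall a, smooth_on (img a) (rep a f).

(* Tensor fields are given by their components: [X a q] is the row of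
   components, at the point q, in the chart a.  Only the values with q in the
   domain of a are meaningful. *)
Definition components (V : Type) := chart N -> N -> V.

(* X'^B = X^A (d y'^B / d y^A) *)
Definition vector_field (X : components 'rV[R]_m) : Prop :=
  (forall a b q, cdom N a q -> cdom N b q ->
     X b q = X a q *m jacobian (trans a b) (ccoord N a q)) /\
  (forall a, smooth_on (img a) (rep a (X a))).

Definition pdc (V : normedModType R) (A : 'I_m) a (f : N -> V) q : V :=
  pd A (rep a f) (ccoord N a q).

Definition vanishes (V : nmodType) (T : components V) : Prop :=
  forall a q, cdom N a q -> T a q = 0.

Definition differential (f : N -> R) : components 'rV[R]_m :=
  fun a q => \row_A pdc A a f q.

(* (d al)_AB = d_A al_B - d_B al_A, i.e.
   d al (Y, Z) = Y (al Z) - Z (al Y) - al [Y, Z] *)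
Definition ext_deriv (al : components 'rV[R]_m) : components 'M[R]_m :=
  fun a q => \matrix_(A, B) (pdc A a (al a) q 0 B - pdc B a (al a) q 0 A).

Definition lie_fun (X : components 'rV[R]_m) (f : N -> R) : components R :=
  fun a q => \sum_A X a q 0 A * pdc A a f q.

Definition lie_bracket (X Y : components 'rV[R]_m) : components 'rV[R]_m :=
  fun a q => \row_A \sum_B
    (X a q 0 B * pdc B a (Y a) q 0 A - Y a q 0 B * pdc B a (X a) q 0 A).

Definition lie_form1 (X al : components 'rV[R]_m) : components 'rV[R]_m :=
  fun a q => \row_A \sum_B
    (X a q 0 B * pdc B a (al a) q 0 A + al a q 0 B * pdc A a (X a) q 0 B).

Definition lie_form2 (X : components 'rV[R]_m) (w : components 'M[R]_m) :
    components 'M[R]_m :=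
  fun a q => \matrix_(A, B) \sum_C
    (X a q 0 C * pdc C a (fun r => w a r A B) q
     + w a q C B * pdc A a (X a) q 0 C
     + w a q A C * pdc B a (X a) q 0 C).

(* al(X) as a function; for a 1-form al and a vector field X, the value does
   not depend on the chart used at q. *)
Definition pairing (al X : components 'rV[R]_m) : N -> R :=
  fun q => xget 0 [set v | exists2 a, cdom N a q
                                    & v = \sum_A al a q 0 A * X a q 0 A].

Definition exact_form (al : components 'rV[R]_m) : Prop :=
  exists2 f : N -> R, smooth_fun f &
    forall a q, cdom N a q -> al a q = differential f a q.

Definition sub_charted (S : set N) : charted R m :=
  @Charted R m {q : N | S q} (chart N)
    (fun a => [set q : {q : N | S q} | cdom N a (sval q)])
    (fun a (q : {q : N | S q}) => ccoord N a (sval q)).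

End Calculus.

(* Second countable Hausdorff smooth manifold of dimension n, given by a smooth
   atlas, which need not be maximal. *)
Record manifold (R : realType) (n : nat) := Manifold {
  mspace : topologicalType;
  mchart : Type;
  mdom : mchart -> set mspace;
  mcoord : mchart -> mspace -> 'rV[R]_n;
  mcharted := @Charted R n mspace mchart mdom mcoord;
  m_hausdorff : hausdorff_space mspace;
  m_second_countable : @second_countable mspace;
  m_cover : forall x, exists a, mdom a x;
  m_open_dom : forall a, open (mdom a);
  m_inj : forall a, set_inj (mdom a) (mcoord a);
  m_continuous : forall a x, mdom a x -> {for x, continuous (mcoord a)};
  m_open_map : forall a (O : set mspace), open O -> O `<=` mdom a ->
    open (mcoord a @` O);
  m_smooth : forall a b,
    smooth_on (mcoord a @` (mdom a `&` mdom b)) (@trans R n mcharted a b) }.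

Coercion mcharted : manifold >-> charted.

Section Cotangent.
Variables (R : realType) (n : nat) (M : manifold R n).

(* A covector at [base]: its components in all charts around [base], related
   by p_i = (d x'^j / d x^i) p'_j.  The last field normalizes the junk
   components, so that equality of covectors is Leibniz equality. *)
Record cotangent := Cotangent {
  base : M;
  momenta : chart M -> 'rV[R]_n;
  momenta_trans : forall a b, cdom M a base -> cdom M b base ->
    momenta a = momenta b *m (jacobian (trans a b) (ccoord M a base))^T;
  momenta_junk : forall a, ~ cdom M a base -> momenta a = 0 }.

(* induced coordinates (x^1, ..., x^n, p_1, ..., p_n) *)
Definition cotangent_bundle : charted R (n + n) :=
  @Charted R (n + n) cotangent (chart M)
    (fun a => [set xi | cdom M a (base xi)])
    (fun a xi => row_mx (ccoord M a (base xi)) (momenta xi a)).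

Definition zero_section : set cotangent_bundle :=
  [set xi : cotangent | forall a, momenta xi a = 0].

Definition slit : charted R (n + n) := sub_charted (~` zero_section).

Definition slit_base (q : slit) : M := base (sval q).
Definition slit_mom (a : chart M) (q : slit) : 'rV[R]_n := momenta (sval q) a.

Definition slit_restrict (H : cotangent_bundle -> R) : slit -> R :=
  fun q => H (sval q).

Definition dx (i : 'I_n) : 'I_(n + n) := lshift n i.
Definition dp (i : 'I_n) : 'I_(n + n) := rshift n i.

Definition liouville : components slit 'rV[R]_(n + n) :=
  fun a q => row_mx (slit_mom a q) 0.

(* = dp_i /\ dx^i, where (al /\ be)(Y, Z) = al Y * be Z - al Z * be Y *)
Definition symplectic : components slit 'M[R]_(n + n) := ext_deriv liouville.

(* the solution rho of i_rho symplectic = - dH *)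
Definition hamiltonian_field (H : cotangent_bundle -> R) :
    components slit 'rV[R]_(n + n) :=
  fun a q => row_mx (\row_i pdc (dp i) a (slit_restrict H) q)
                    (\row_i - pdc (dx i) a (slit_restrict H) q).

Definition complete_lift (X : components M 'rV[R]_n) :
    components slit 'rV[R]_(n + n) :=
  fun a q => row_mx (X a (slit_base q))
    (\row_i - \sum_j slit_mom a q 0 j * pdc (N := M) i a (X a) (slit_base q) 0 j).

Definition metric (H : cotangent_bundle -> R) : components slit 'M[R]_n :=
  fun a q => \matrix_(i, j)
    pd (dp i) (pd (dp j) (rep a (slit_restrict H))) (ccoord slit a q).

End Cotangent.

(* A is congruent to a diagonal matrix with r positive and s negative entries *)
Definition has_signature (R : realType) (n : nat) (A : 'M[R]_n) (r s : nat) :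
    Prop :=
  exists P : 'M[R]_n, exists d : 'rV[R]_n,
    [/\ P \in unitmx, P *m A *m P^T = diag_mx d,
        #|[pred i | 0 < d 0 i]| = r & #|[pred i | d 0 i < 0]| = s].

(* Continuity on the zero section is continuity of H, as a function on the whole
   cotangent bundle, at each zero covector. *)
Definition hamilton_space (R : realType) (n : nat) (M : manifold R n)
    (H : cotangent_bundle M -> R) : Prop :=
  [/\ smooth_fun (slit_restrict H),
      forall a (xi : cotangent_bundle M), cdom _ a xi -> zero_section xi ->
        {for ccoord _ a xi, continuous (rep a H)},
      forall a (q : slit M), cdom _ a q -> \rank (metric H a q) = n
    & exists r s : nat, forall a (q : slit M), cdom _ a q ->
        has_signature (metric H a q) r s].

Section Symmetries.
Variables (R : realType) (n : nat) (M : manifold R n).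
Variable H : cotangent_bundle M -> R.

Definition noether_symmetry (X : components (slit M) 'rV[R]_(n + n)) : Prop :=
  [/\ vector_field X, vanishes (lie_form2 X (@symplectic R n M))
    & vanishes (lie_fun X (slit_restrict H))].

Definition exact_noether_symmetry (X : components (slit M) 'rV[R]_(n + n)) :
    Prop :=
  noether_symmetry X /\ exact_form (lie_form1 X (@liouville R n M)).

Definition natural_symmetry (X : components M 'rV[R]_n) : Prop :=
  vector_field X /\
  vanishes (lie_bracket (hamiltonian_field H) (complete_lift X)).

Definition conservation_law (f : slit M -> R) : Prop :=
  smooth_fun f /\ vanishes (lie_fun (hamiltonian_field H) f).

Definition invariant_field (X : components M 'rV[R]_n) : Prop :=
  vector_field X /\ vanishes (lie_fun (complete_lift X) (slit_restrict H)).

End Symmetries.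

(* Main.v *)
From HB Require Import structures.
Require Import Defs.
From mathcomp Require Import all_boot all_order all_algebra.
From mathcomp Require Import all_classical all_reals all_analysis.

Set Implicit Arguments.
Unset Strict Implicit.
Unset Printing Implicit Defensive.

Import Order.TTheory GRing.Theory Num.Theory.
Import numFieldNormedType.Exports.
Local Open Scope classical_set_scope.
Local Open Scope ring_scope.

(** In induced coordinates (x, p) put theta = (p, 0), Omega = the constant matrix
    of omega = d theta, and let L = (xi, - p_j d_i xi^j) be the complete lift of
    the field xi.  The momentum part of L is chosen exactly so that
    L_L theta = 0 ([lie_theta]): the term p_j d_i xi^j coming from the derivative
    of xi cancels the derivative of p_i along L.  So L_L theta is exact with
    primitive 0.

    Let K be the matrix of partial derivatives of L.  As Omega is constant, L_L
    omega is K Omega + Omega K^T.  In this sum everything cancels except the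
    antisymmetric part of the second derivatives of p_j xi^j, which is zero
    ([lift_symplectic]).  With L(H) = 0, which is the hypothesis, L is an exact
    Noether symmetry.

    The Hamiltonian field is rho = dH Omega.  Differentiating L(H) = 0 and using
    the symmetry of the Hessian of H, the derivative of dH along L is - dH K^T;
    hence [rho, L] = dH (Omega K + K^T Omega), which is zero because Omega^2 = - 1
    turns K Omega + Omega K^T = 0 into Omega K + K^T Omega = 0 ([bracket_zero]).
    Finally rho (p_i xi^i) = - L(H) = 0 ([fiber_dot_conserved]).

    Two facts are global.  The pairing p_i xi^i does not depend on the chart
    ([pairing_liouville]), by the transformation rules of vectors and covectors.
    And L is a vector field on the slit cotangent bundle
    ([complete_lift_trans]): write p' for the momenta in a second chart and phi
    for the transition map.  Deriving the identity p'_j d_i phi^j = p_i along L,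
    and the identity xi' o phi = d phi (xi) along the i-th coordinate, one finds
    that L(p') and - p'_j d'_k xi'^j have the same product with the
    invertible matrix d phi.

    Symmetry of second derivatives ([schwarz]) is used for the Hessian of H, for
    xi and for phi.  To compute derivatives in a chart, one also needs that the
    chart images of the slit cotangent bundle are open; they are described in
    [slit_imgE], which rests on the construction of covectors with prescribed
    momenta ([covector]). *)

(** * Directional derivatives *)

Section Derivatives.
Variables (R : realType) (U V W : normedModType R).

Lemma near_differentiable (f g : V -> W) x :
  (\near x, f x = g x) -> differentiable f x -> differentiable g x.
Proof.
move=> fg df; have fgx := nbhs_singleton fg.
have gE : g \o shift x = cst (g x) + 'd f x +o_ 0 id.
  apply/eqaddoP => _ /posnumP[e].
  have [_ /eqaddoP/(_ e%:num [gt0 of e%:num])] := proj1 (diff_locallyP x f) df.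
  have fg0 : \forall h \near 0, f (h + x) = g (h + x).
    by move: fg; rewrite (near_shift 0 x); apply: filterS => h; rewrite /= subr0.
  apply: filterS2 fg0 => h fgh.
  by rewrite !fctE /= fgx fgh.
apply/diff_locallyP; have [dfc _] := proj1 (diff_locallyP x f) df.
by rewrite (diff_unique dfc gE).
Qed.

Lemma linear_diff (L : V -> W) x :
  linear L -> continuous L -> is_diff x L L.
Proof.
move=> Llin Lcont.
pose LM := GRing.isLinear.Build _ _ _ _ _ Llin.
pose L' : {linear _ -> _} := HB.pack L LM.
split; first exact: (@linear_differentiable _ _ _ L').
exact: (@diff_lin _ _ _ L').
Qed.

Lemma derive_comp (f : U -> V) (g : V -> W) x v :
  differentiable f x -> differentiable g (f x) ->
  'D_v (fun y => g (f y)) x = 'D_('D_v f x) g (f x).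
Proof.
move=> df dg; have dgf := differentiable_comp df dg.
by rewrite (deriveE _ dgf) diff_comp //= -!deriveE.
Qed.

Lemma derive_linear (L : V -> W) x v : linear L -> continuous L ->
  'D_v L x = L v.
Proof.
by move=> lL cL; have dL := linear_diff x lL cL; rewrite deriveE // diff_val.
Qed.

Lemma derive_linear_comp (L : V -> W) (f : U -> V) x v :
  linear L -> continuous L -> differentiable f x ->
  'D_v (fun y => L (f y)) x = L ('D_v f x).
Proof.
move=> lL cL df; have dL := linear_diff (f x) lL cL.
by rewrite derive_comp // derive_linear.
Qed.

End Derivatives.

Section Rows.
Variables (R : realType) (m : nat).
Implicit Types (x v : 'rV[R]_m).

Lemma coord_linear i : linear (fun y : 'rV[R]_m => y 0 i).
Proof. by move=> k u v; rewrite !mxE. Qed.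

(** Linearity of the differential turns the coordinate sums that define Lie
    derivatives into single directional derivatives. *)
Lemma derive_dirE (V : normedModType R) (f : 'rV[R]_m -> V) x v :
  differentiable f x -> 'D_v f x = \sum_A v 0 A *: 'D_(delta_mx 0 A) f x.
Proof.
move=> df; rewrite deriveE // {1}[v]row_sum_delta linear_sum /=.
by apply: eq_bigr => A _; rewrite linearZ /= deriveE.
Qed.

End Rows.

(** * Symmetry of second derivatives *)

Section Schwarz.
Variables (R : realType) (m : nat).
Implicit Types (f : 'rV[R]_m -> R) (U : set 'rV[R]_m) (x u v : 'rV[R]_m).

Lemma is_derive_line f x v (t : R) : differentiable f (x + t *: v) ->
  is_derive t 1 (fun s : R => f (x + s *: v)) ('D_v f (x + t *: v)).
Proof.
move=> df.
have ds : is_diff t (fun s : R => s *: v) ( *:%R^~ v) by exact: is_diff_scalel.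
have dl : is_diff t (fun s : R => x + s *: v) (0 + *:%R^~ v).
  exact: (is_diffD (is_diff_cst x t) ds).
have dl' := @ex_diff _ _ _ _ _ _ _ dl.
have e : 'D_1 (fun s : R => x + s *: v) t = v.
  by rewrite deriveE // diff_val /= !fctE /= add0r scale1r.
split; first by apply/diff_derivable/(differentiable_comp dl' df).
by rewrite (derive_comp _ dl' df) e.
Qed.

Lemma mean_value_line f x v (s : R) : 0 < s ->
  (forall t, 0 <= t <= s -> differentiable f (x + t *: v)) ->
  exists2 t, 0 < t < s & f (x + s *: v) - f x = s * 'D_v f (x + t *: v).
Proof.
move=> s0 df.
have [||t] := @MVT R (fun t => f (x + t *: v)) (fun t => 'D_v f (x + t *: v)) 0 s s0.
- move=> t; rewrite in_itv /= => /andP[t0 ts].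
  by apply/is_derive_line/df; rewrite !ltW.
- apply/continuous_in_subspaceT => t; rewrite inE /= in_itv /= => tI.
  apply/differentiable_continuous/derivable1_diffP.
  by have [] := is_derive_line (df t tI).
rewrite in_itv /= => tI; rewrite scale0r addr0 subr0 mulrC => e.
by exists t.
Qed.

(** The mean value theorem is applied first along u to the increment
    f (y + s v) - f y, and then along v to D_u f.  The same second difference is
    symmetric in u and v, which is what makes it useful for [schwarz]. *)
Lemma second_difference U f x u v (s : R) : 0 < s -> Ck 2 U f ->
  (forall a b, 0 <= a <= s -> 0 <= b <= s -> U (x + a *: u + b *: v)) ->
  exists a b, [/\ 0 < a < s, 0 < b < s &
    f (x + s *: u + s *: v) - f (x + s *: u) - f (x + s *: v) + f x
    = s * s * 'D_v (fun y => 'D_u f y) (x + a *: u + b *: v)].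
Proof.
move=> s0 [df /(_ u) [ddf _]] hU.
have s00 : 0 <= (0 : R) <= s by rewrite lexx ltW.
have ss : 0 <= s <= s by rewrite lexx ltW.
(* The second difference is the increment of g along s *: u. *)
pose g y := f (y + s *: v) - f y.
have dsh (y : 'rV[R]_m) : is_diff y (fun y => y + s *: v) id.
  have -> : (fun y => y + s *: v) = id + cst (s *: v) by [].
  have h := is_diffD (is_diff_id y) (is_diff_cst (s *: v) y).
  by split; [exact: (@ex_diff _ _ _ _ _ _ _ h)|rewrite diff_val addr0].
have dg y : U (y + s *: v) -> U y -> differentiable g y /\
    'D_u g y = 'D_u f (y + s *: v) - 'D_u f y.
  move=> Uys Uy.
  have d1 : differentiable (fun y => f (y + s *: v)) y.
    by apply: (@differentiable_comp _ _ _ _ (fun y => y + s *: v)) => //; exact: df.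
  have d2 := df _ Uy.
  split; first exact: (differentiableB d1 d2).
  rewrite (deriveB (diff_derivable d1) (diff_derivable d2)); congr (_ - _).
  rewrite (@derive_comp _ _ _ _ (fun y => y + s *: v)) //; last exact: df.
  by rewrite (deriveE _ (@ex_diff _ _ _ _ _ _ _ (dsh y))) diff_val.
have Ua t : 0 <= t <= s -> U (x + t *: u).
  by move=> tI; have := hU t 0 tI s00; rewrite scale0r addr0.
have Uas t : 0 <= t <= s -> U (x + t *: u + s *: v) by move=> tI; exact: hU tI ss.
have [|a aI ea] := @mean_value_line g x u s s0.
  by move=> t tI; have [] := dg _ (Uas t tI) (Ua t tI).
have aI' : 0 <= a <= s by case/andP: aI => *; rewrite !ltW.
have [|b bI eb] := @mean_value_line (fun y => 'D_u f y) (x + a *: u) v s s0.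
  by move=> t tI; apply: ddf; exact: hU.
exists a, b; split => //.
have [_ e] := dg _ (Uas _ aI') (Ua _ aI').
by rewrite -mulrA -eb -e -ea /g opprB addrA addrAC.
Qed.

(** By [second_difference] in both orders, on every small parallelogram at x
    the two mixed derivatives agree up to a displacement of the point, and they
    are continuous at x. *)
Lemma schwarz U f x u v : open U -> U x -> Ck 2 U f ->
  'D_v (fun y => 'D_u f y) x = 'D_u (fun y => 'D_v f y) x.
Proof.
move=> oU Ux fC.
have cont (w z : 'rV[R]_m) : {for x, continuous (fun y => 'D_w (fun y => 'D_z f y) y)}.
  by have [_ /(_ z) [_ /(_ w) /(_ _ Ux)]] := fC.
apply/eqP; rewrite -subr_eq0 -normr_le0; apply/ler_addgt0Pr => e e0; rewrite add0r.
have e2 : 0 < e / 2 by rewrite divr_gt0.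
pose close w z : set 'rV[R]_m := [set y |
  `|'D_w (fun y => 'D_z f y) x - 'D_w (fun y => 'D_z f y) y| < e / 2].
have ncl w z : nbhs x (close w z).
  exact: ((cvgrPdist_lt (FF := nbhs_filter x) _ _).1 (cont w z) _ e2).
have nb : nbhs x (U `&` (close v u `&` close u v)).
  by apply: filterI; [exact: open_nbhs_nbhs|apply: filterI; exact: ncl].
have [r /= r0 hr] := (@nbhs_ballP _ _ x _).1 nb.
(* A side s for which the parallelogram spanned by s *: u, s *: v lies in the ball. *)
pose N := `|u| + `|v| + 1; have N0 : 0 < N by rewrite ltr_pwDr // addr_ge0.
pose s := r / (2 * N); have s0 : 0 < s by rewrite divr_gt0 // mulr_gt0.
have inb a b : 0 <= a <= s -> 0 <= b <= s -> ball x r (x + a *: u + b *: v).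
  move=> /andP[a0 as_] /andP[b0 bs].
  rewrite -ball_normE /= -addrA opprD addrA subrr add0r normrN.
  have h1 : `|a *: u + b *: v| <= s * N.
    apply: (le_trans (ler_normD _ _)); rewrite !normrZ !ger0_norm //.
    rewrite /N mulrDr mulr1 mulrDr (le_trans _ (_ : s * `|u| + s * `|v| <= _)) //.
      by rewrite lerD // ler_wpM2r.
    by rewrite lerDl ltW.
  apply: (le_lt_trans h1); rewrite /s invfM mulrA divfK ?gt_eqF //.
  by rewrite ltr_pdivrMr // ltr_pMr // ltr1n.
have [a [b [/andP[a0 as_] /andP[b0 bs] E1]]] := second_difference s0 fC
  (fun a b ha hb => (hr _ (inb a b ha hb)).1).
have [|a' [b' [/andP[a0' as'] /andP[b0' bs'] E2]]] :=
   @second_difference U f x v u s s0 fC.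
  by move=> c d hc hd; rewrite addrAC; exact: (hr _ (inb d c hd hc)).1.
have {}E1 : 'D_v (fun y => 'D_u f y) (x + a *: u + b *: v) =
   'D_u (fun y => 'D_v f y) (x + a' *: v + b' *: u).
  apply: (@mulfI _ (s * s)); first by rewrite mulf_neq0 ?gt_eqF.
  apply: (etrans (esym E1)); apply: etrans E2; congr (_ + _).
  by rewrite addrAC; congr (f _ - _ - _); exact: addrAC.
have [_ [n1 _]] := hr _ (inb a b (introT andP (conj (ltW a0) (ltW as_)))
  (introT andP (conj (ltW b0) (ltW bs)))).
have [_ [_ n2]] := hr _ (inb b' a' (introT andP (conj (ltW b0') (ltW bs')))
  (introT andP (conj (ltW a0') (ltW as')))).
rewrite /close /= in n1 n2; rewrite (addrAC x (b' *: u)) -E1 in n2.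
apply: ltW; rewrite [ltRHS]splitr.
apply: (le_lt_trans (ler_distD ('D_v (fun y => 'D_u f y) (x + a *: u + b *: v)) _ _)).
apply: ltrD; first exact: n1.
rewrite distrC; exact: n2.
Qed.

End Schwarz.

(** * Closure properties of smooth functions *)

Section Smoothness.
Variables (R : realType) (m : nat).
Implicit Types (V W : normedModType R) (U : set 'rV[R]_m) (k : nat).

Lemma CkW V U (f : 'rV[R]_m -> V) k : Ck k.+1 U f -> Ck k U f.
Proof.
elim: k f => [|k IH] f [df ddf].
  by move=> y Uy; exact/differentiable_continuous/df.
by split=> // v; exact/IH/ddf.
Qed.

Lemma Ck_ext V U (f g : 'rV[R]_m -> V) k : open U ->
  (forall y, U y -> f y = g y) -> Ck k U f -> Ck k U g.
Proof.
move=> oU; elim: k f g => [|k IH] f g fg.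
  move=> cf y Uy; have fgy : \forall z \near y, f z = g z.
    by apply: filterS fg _; exact: open_nbhs_nbhs.
  rewrite /prop_for /continuous_at -(fg _ Uy).
  exact: cvg_trans (near_eq_cvg fgy) (cf y Uy).
have near_fg y : U y -> \forall z \near y, f z = g z.
  by move=> Uy; apply: filterS fg _; exact: open_nbhs_nbhs.
move=> [df ddf]; split=> [y Uy|v].
  exact: near_differentiable (near_fg y Uy) (df y Uy).
by apply: IH (ddf v) => y Uy; apply: near_eq_derive (near_fg y Uy).
Qed.

Lemma Ck_cst V U (c : V) k : Ck k U (fun=> c).
Proof.
elim: k c => [|k IH] c; first by move=> y _; exact: cst_continuous.
split=> [y _|v]; first exact: differentiable_cst.
have -> : (fun y : 'rV[R]_m => 'D_v (fun=> c) y) = fun=> 0; last exact: IH.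
  by apply/funext => y; exact: derive_cst.
Qed.

Lemma Ck_linear_comp V W U (L : V -> W) (f : 'rV[R]_m -> V) k :
  open U -> linear L -> continuous L -> Ck k U f -> Ck k U (fun y => L (f y)).
Proof.
move=> oU lL cL; elim: k f => [|k IH] f.
  by move=> cf y Uy; apply: (@continuous_comp _ _ _ f L); [exact: cf|exact: cL].
move=> [df ddf]; split=> [y Uy|v].
  have dL := @ex_diff _ _ _ _ _ _ _ (linear_diff (f y) lL cL).
  exact: differentiable_comp (df y Uy) dL.
apply: Ck_ext oU _ (IH _ (ddf v)) => y Uy.
by rewrite (derive_linear_comp _ lL cL (df y Uy)).
Qed.

Lemma CkD V U (f g : 'rV[R]_m -> V) k : open U ->
  Ck k U f -> Ck k U g -> Ck k U (fun y => f y + g y).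
Proof.
move=> oU; elim: k f g => [|k IH] f g.
  by move=> cf cg y Uy; apply: continuousD; [exact: cf|exact: cg].
move=> [df ddf] [dg ddg]; split=> [y Uy|v].
  exact: differentiableD (df y Uy) (dg y Uy).
apply: Ck_ext oU _ (IH _ _ (ddf v) (ddg v)) => y Uy.
by rewrite -(deriveD (diff_derivable (df y Uy)) (diff_derivable (dg y Uy))).
Qed.

Lemma CkM U (f g : 'rV[R]_m -> R) k : open U ->
  Ck k U f -> Ck k U g -> Ck k U (fun y => f y * g y).
Proof.
move=> oU; elim: k f g => [|k IH] f g.
  by move=> cf cg y Uy; apply: continuousM; [exact: cf|exact: cg].
move=> /[dup] /CkW cf [df ddf] /[dup] /CkW cg [dg ddg]; split=> [y Uy|v].
  exact: differentiableM (df y Uy) (dg y Uy).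
apply: Ck_ext oU _ (CkD oU (IH _ _ cf (ddg v)) (IH _ _ cg (ddf v))) => y Uy.
by rewrite -(deriveM (diff_derivable (df y Uy)) (diff_derivable (dg y Uy))).
Qed.

Lemma Ck_sum V U (I : Type) (r : seq I) (f : I -> 'rV[R]_m -> V) k : open U ->
  (forall i, Ck k U (f i)) -> Ck k U (fun y => \sum_(i <- r) f i y).
Proof.
move=> oU cf; elim: r => [|i r IH].
  by apply: Ck_ext oU _ (Ck_cst U 0 k) => y _; rewrite big_nil.
by apply: Ck_ext oU _ (CkD oU (cf i) IH) => y _; rewrite big_cons.
Qed.

Lemma Ck_coord n U (f : 'rV[R]_m -> 'rV[R]_n) i k : open U ->
  Ck k U f -> Ck k U (fun y => f y 0 i).
Proof.
move=> oU; apply: Ck_linear_comp oU (@coord_linear _ _ i) _.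
exact: coord_continuous.
Qed.

(** A row is the sum of its coordinates times fixed basis rows, so it is enough
    to treat real-valued functions. *)
Lemma Ck_row n U (f : 'rV[R]_m -> 'rV[R]_n) k : open U ->
  (forall i, Ck k U (fun y => f y 0 i)) -> Ck k U f.
Proof.
move=> oU cf.
have h i : Ck k U (fun y => f y 0 i *: (delta_mx 0 i : 'rV[R]_n)).
  pose L (c : R^o) := c *: (delta_mx 0 i : 'rV[R]_n).
  apply: (@Ck_linear_comp R^o _ _ L) (cf i) => //.
    by move=> c u v; rewrite /L scalerDl scalerA.
  exact: scalel_continuous.
by apply: Ck_ext oU _ (Ck_sum (index_enum 'I_n) oU h) => y _; rewrite -row_sum_delta.
Qed.

Lemma Ck_derive V U (f : 'rV[R]_m -> V) v :
  smooth_on U f -> smooth_on U (fun y => 'D_v f y).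
Proof. by move=> sf k; have [_] := sf k.+1; exact. Qed.

Lemma smooth_diff V U (f : 'rV[R]_m -> V) y :
  smooth_on U f -> U y -> differentiable f y.
Proof. by move=> sf; have [df _] := sf 1%N; exact: df. Qed.

End Smoothness.

Lemma Ck_comp_linear (R : realType) (p m k : nat) (V : normedModType R)
    (L : 'rV[R]_p -> 'rV[R]_m) (U : set 'rV[R]_m) (f : 'rV[R]_m -> V) :
  open U -> linear L -> continuous L -> Ck k U f ->
  Ck k (L @^-1` U) (fun y => f (L y)).
Proof.
move=> oU0 lL cL; have oU : open (L @^-1` U) by apply: open_comp oU0 => y _; exact: cL.
elim: k f => [|k IH] f.
  by move=> cf y Uy; apply: (@continuous_comp _ _ _ L f); [exact: cL|exact: cf].
have dL y := @ex_diff _ _ _ _ _ _ _ (linear_diff y lL cL).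
move=> [df ddf]; split=> [y Uy|v]; first exact: differentiable_comp (dL y) (df _ Uy).
apply: Ck_ext oU _ (IH _ (ddf (L v))) => y Uy.
by rewrite (derive_comp _ (dL y) (df _ Uy)) (derive_linear _ _ lL cL).
Qed.

Lemma smooth_onS (R : realType) (m : nat) (V : normedModType R) (U U' : set 'rV[R]_m)
  (f : 'rV[R]_m -> V) : U `<=` U' -> smooth_on U' f -> smooth_on U f.
Proof.
move=> UU' sf k; elim: k f {sf}(sf k) => [|k IH] f.
  by move=> cf y /UU'; exact: cf.
by move=> [df ddf]; split=> [y /UU'|v]; [exact: df|exact/IH/ddf].
Qed.

Lemma rV_linear_continuous (R : realType) (m : nat) (V : normedModType R)
  (L : 'rV[R]_m -> V) : linear L -> continuous L.
Proof.
move=> lL y.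
pose LM := GRing.isLinear.Build _ _ _ _ _ lL.
pose L' : {linear _ -> _} := HB.pack L LM.
have h A : Ck 0 setT (fun y : 'rV[R]_m => y 0 A *: L (delta_mx 0 A)).
  move=> z _; apply: (@continuous_comp _ _ _ (fun y : 'rV[R]_m => y 0 A)
    ( *:%R^~ (L (delta_mx 0 A)))).
    exact: coord_continuous.
  exact: scalel_continuous.
have := Ck_sum (index_enum 'I_m) (@openT _) h.
have -> : (fun y : 'rV[R]_m =>
    \sum_(A <- index_enum 'I_m) y 0 A *: L (delta_mx 0 A)) = L.
  apply/funext => z; rewrite {2}(row_sum_delta z) -[RHS]/(L' _) linear_sum.
  by apply: eq_bigr => A _; rewrite linearZ.
by apply.
Qed.

(** * Row-valued functions *)

Section Dot.
Variables (R : realType) (n : nat).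
Implicit Types (u v w : 'rV[R]_n).

Definition dot u w : R := \sum_j u 0 j * w 0 j.

Lemma dotE u w : dot u w = (u *m w^T) 0 0.
Proof. by rewrite mxE; apply: eq_bigr => j _; rewrite mxE. Qed.

Lemma dotC u w : dot u w = dot w u.
Proof. by apply: eq_bigr => j _; rewrite mulrC. Qed.

Lemma dot_mulmxr u w (A : 'M[R]_n) : dot u (w *m A) = dot (u *m A^T) w.
Proof. by rewrite !dotE trmx_mul mulmxA. Qed.

Lemma dot0l w : dot 0 w = 0.
Proof. by rewrite /dot big1 // => j _; rewrite mxE mul0r. Qed.

Lemma dot0r u : dot u 0 = 0.
Proof. by rewrite dotC dot0l. Qed.

Lemma dotNl u w : dot (- u) w = - dot u w.
Proof. by rewrite /dot -sumrN; apply: eq_bigr => j _; rewrite mxE mulNr. Qed.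

Lemma dot_delta i w : dot (delta_mx 0 i) w = w 0 i.
Proof. by rewrite dotE -rowE !mxE. Qed.

Lemma mulmx_tr_coord u (A : 'M[R]_n) i : (u *m A^T) 0 i = dot u (row i A).
Proof. by rewrite mxE; apply: eq_bigr => j _; rewrite !mxE. Qed.

End Dot.

Lemma dot_row_mx (R : realType) n k (a c : 'rV[R]_n) (b d : 'rV[R]_k) :
  dot (row_mx a b) (row_mx c d) = dot a c + dot b d.
Proof. by rewrite !dotE tr_row_mx mul_row_col mxE. Qed.

Section DotDerivative.
Variables (R : realType) (V : normedModType R) (n : nat).
Implicit Types (f g : V -> 'rV[R]_n) (x v : V).

Lemma coord_diff f x i : differentiable f x -> differentiable (fun y => f y 0 i) x.
Proof.
by move=> df; exact: (differentiable_comp df (differentiable_coord (f x) 0 i)).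
Qed.

Lemma derive_coord f x v i : differentiable f x ->
  'D_v (fun y => f y 0 i) x = 'D_v f x 0 i.
Proof.
move=> df; apply: (derive_linear_comp _ (@coord_linear _ _ i) _ df).
exact: coord_continuous.
Qed.

Lemma derive_dot f g x v : differentiable f x -> differentiable g x ->
  'D_v (fun y => dot (f y) (g y)) x = dot ('D_v f x) (g x) + dot (f x) ('D_v g x).
Proof.
move=> df dg.
have dfj j := diff_derivable (v := v) (coord_diff j df).
have dgj j := diff_derivable (v := v) (coord_diff j dg).
have -> : (fun y => dot (f y) (g y))
    = \sum_(j < n) ((fun y => f y 0 j) * (fun y => g y 0 j)).
  by apply/funext => y; rewrite fct_sumE.
rewrite derive_sum; last by move=> j; exact: derivableM.
rewrite /dot -big_split; apply: eq_bigr => j _ /=.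
rewrite (deriveM (dfj j) (dgj j)) (derive_coord v j df) (derive_coord v j dg).
by rewrite addrC; congr (_ + _); exact: mulrC.
Qed.

End DotDerivative.

Section RowFunctions.
Variables (R : realType) (V : normedModType R).

Lemma row_diff n (f : V -> 'rV[R]_n) x :
  (forall i, differentiable (fun y => f y 0 i) x) -> differentiable f x.
Proof.
move=> df; have -> : f = \sum_(i < n) (fun y => f y 0 i *: (delta_mx 0 i : 'rV[R]_n)).
  by apply/funext => y; rewrite fct_sumE; exact: row_sum_delta.
by apply: differentiable_sum => i; exact: differentiableZl (df i).
Qed.

Lemma dot_diff n (f g : V -> 'rV[R]_n) x :
  differentiable f x -> differentiable g x ->
  differentiable (fun y => dot (f y) (g y)) x.
Proof.
move=> df dg.
have -> : (fun y => dot (f y) (g y))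
    = \sum_(j < n) ((fun y => f y 0 j) * (fun y => g y 0 j)).
  by apply/funext => y; rewrite fct_sumE.
apply: differentiable_sum => j.
exact: differentiableM (coord_diff j df) (coord_diff j dg).
Qed.

Lemma row_mx_diff n k (f : V -> 'rV[R]_n) (g : V -> 'rV[R]_k) x :
  differentiable f x -> differentiable g x ->
  differentiable (fun y => row_mx (f y) (g y)) x.
Proof.
move=> df dg; apply: row_diff => A; case: (split_ordP A) => i ->.
  have -> : (fun y => row_mx (f y) (g y) 0 (lshift k i)) = (fun y => f y 0 i).
    by apply/funext => y; rewrite row_mxEl.
  exact: coord_diff.
have -> : (fun y => row_mx (f y) (g y) 0 (rshift n i)) = (fun y => g y 0 i).
  by apply/funext => y; rewrite row_mxEr.
exact: coord_diff.
Qed.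

Lemma derive_row_mx n k (f : V -> 'rV[R]_n) (g : V -> 'rV[R]_k) x v :
  differentiable f x -> differentiable g x ->
  'D_v (fun y => row_mx (f y) (g y)) x = row_mx ('D_v f x) ('D_v g x).
Proof.
move=> df dg; have dfg := row_mx_diff df dg.
apply/rowP => A; apply: (etrans (esym (derive_coord v A dfg))).
case: (split_ordP A) => i ->.
  have -> : (fun y => row_mx (f y) (g y) 0 (lshift k i)) = (fun y => f y 0 i).
    by apply/funext => y; rewrite row_mxEl.
  by rewrite row_mxEl; exact: derive_coord.
have -> : (fun y => row_mx (f y) (g y) 0 (rshift n i)) = (fun y => g y 0 i).
  by apply/funext => y; rewrite row_mxEr.
by rewrite row_mxEr; exact: derive_coord.
Qed.

End RowFunctions.

Section DotSmooth.
Variables (R : realType) (m n : nat) (U : set 'rV[R]_m).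
Hypothesis oU : open U.

Lemma smooth_dot (f g : 'rV[R]_m -> 'rV[R]_n) : smooth_on U f -> smooth_on U g ->
  smooth_on U (fun y => dot (f y) (g y)).
Proof.
move=> sf sg k; apply: Ck_sum => // j.
by apply: CkM => //; exact: Ck_coord.
Qed.

End DotSmooth.

Lemma schwarz_row (R : realType) (m k : nat) (U : set 'rV[R]_m)
    (f : 'rV[R]_m -> 'rV[R]_k) (x u v : 'rV[R]_m) :
  open U -> U x -> smooth_on U f ->
  'D_v (fun y => 'D_u f y) x = 'D_u (fun y => 'D_v f y) x.
Proof.
move=> oU Ux sf; apply/rowP => i.
have dd w := smooth_diff (Ck_derive w sf) Ux.
have near_coord w : \forall y \near x, 'D_w f y 0 i = 'D_w (fun y => f y 0 i) y.
  apply: filterS (open_nbhs_nbhs (conj oU Ux)) => y Uy.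
  exact/esym/derive_coord/(smooth_diff sf Uy).
have e1 := derive_coord v i (dd u).
have e2 := derive_coord u i (dd v).
apply: (etrans (esym e1)); apply: (etrans _ e2).
have e3 := near_eq_derive v (near_coord u).
have e4 := near_eq_derive u (near_coord v).
apply: (etrans e3); apply: (etrans _ (esym e4)).
by apply: (schwarz u v oU Ux); exact: Ck_coord.
Qed.

(** The linear map v -> p . D_v f is represented by its values on the basis. *)
Lemma dot_derive_dir (R : realType) (m k : nat) (f : 'rV[R]_m -> 'rV[R]_k)
    (p : 'rV[R]_k) (x v : 'rV[R]_m) : differentiable f x ->
  dot p ('D_v f x) = dot v (\row_i dot p ('D_(delta_mx 0 i) f x)).
Proof.
move=> df; rewrite (derive_dirE _ df) /dot.
under eq_bigr do rewrite summxE mulr_sumr.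
rewrite exchange_big; apply: eq_bigr => i _ /=; rewrite mxE mulr_sumr.
by apply: eq_bigr => j _; rewrite mxE mulrCA.
Qed.

Lemma mulmxr_linear (R : realType) k l (A : 'M[R]_(k, l)) :
  linear (mulmxr A : 'rV[R]_k -> 'rV[R]_l).
Proof. by move=> c u w; rewrite linearP. Qed.

Lemma mulmxr_diff (R : realType) (V : normedModType R) k l (g : V -> 'rV[R]_k)
    (A : 'M[R]_(k, l)) z :
  differentiable g z -> differentiable (fun z => g z *m A) z.
Proof.
move=> dg; have lA := mulmxr_linear A.
exact: differentiable_comp dg
  (@ex_diff _ _ _ _ _ _ _ (linear_diff (g z) lA (rV_linear_continuous lA))).
Qed.

Lemma derive_mulmxr (R : realType) (V : normedModType R) k l (g : V -> 'rV[R]_k)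
    (A : 'M[R]_(k, l)) z v :
  differentiable g z -> 'D_v (fun z => g z *m A) z = 'D_v g z *m A.
Proof.
move=> dg; have lA := mulmxr_linear A.
exact: derive_linear_comp lA (rV_linear_continuous lA) dg.
Qed.

Definition gradient (R : realType) (m : nat) (h : 'rV[R]_m -> R) y : 'rV[R]_m :=
  \row_A 'D_(delta_mx 0 A) h y.

Lemma smooth_gradient (R : realType) (m : nat) (W : set 'rV[R]_m) (h : 'rV[R]_m -> R) :
  open W -> smooth_on W h -> smooth_on W (gradient h).
Proof.
move=> oW sh k; apply: Ck_row => // A.
have := Ck_derive (delta_mx 0 A) sh k.
by apply: Ck_ext => // y _; rewrite mxE.
Qed.

(** * Charts and coordinate expressions *)

Section Charts.
Variables (R : realType) (m : nat) (N : charted R m).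

(** The two properties of an atlas which make [rep a f] the coordinate expression
    of f on a neighbourhood of each point of the chart; both a manifold and its
    slit cotangent bundle have them. *)
Definition regular_charts :=
  (forall a, set_inj (cdom N a) (ccoord N a)) /\ (forall a, open (@img R m N a)).

Hypothesis regN : regular_charts.
Variables (V : normedModType R) (a : chart N) (f : N -> V).

Lemma rep_ccoord q : cdom N a q -> rep a f (ccoord N a q) = f q.
Proof.
move=> aq; apply: xget_unique; first by exists q.
move=> _ [q' [aq' /= e] <-]; congr f.
by apply: regN.1 e; rewrite inE.
Qed.

Lemma near_rep (F : 'rV[R]_m -> V) q : cdom N a q ->
  (forall q', cdom N a q' -> f q' = F (ccoord N a q')) ->
  \forall y \near ccoord N a q, rep a f y = F y.
Proof.
move=> aq fF; have : nbhs (ccoord N a q) (img a).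
  by apply: open_nbhs_nbhs; split; [exact: regN.2|exists q].
by apply: filterS => _ [q' aq' <-]; rewrite rep_ccoord // fF.
Qed.

(** A partial derivative of [rep a f], which is junk off the image of the chart,
    can be computed from any formula F that represents f on the chart. *)
Lemma pdc_local (F : 'rV[R]_m -> V) A q : cdom N a q ->
  (forall q', cdom N a q' -> f q' = F (ccoord N a q')) ->
  pdc A a f q = 'D_(delta_mx 0 A) F (ccoord N a q).
Proof. by move=> aq fF; exact: near_eq_derive (near_rep aq fF). Qed.

Lemma smooth_rep (F : 'rV[R]_m -> V) :
  (forall q', cdom N a q' -> f q' = F (ccoord N a q')) ->
  smooth_on (img a) F -> smooth_on (img a) (rep a f).
Proof.
move=> fF sF k; apply: Ck_ext (sF k); first exact: regN.2.
by move=> _ [q aq <-]; rewrite rep_ccoord // fF.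
Qed.

End Charts.

(** * Changes of coordinates on the manifold *)

Section Transitions.
Variables (R : realType) (n : nat) (M : manifold R n).
Implicit Types (a b c : chart M) (x : M).

Lemma manifold_regular : regular_charts M.
Proof. by split=> a; [exact: m_inj|exact: m_open_map (@m_open_dom _ _ M a) _]. Qed.

Lemma trans_ccoord a b x : cdom M a x ->
  trans a b (ccoord M a x) = ccoord M b x.
Proof. by move=> ax; exact: (rep_ccoord manifold_regular). Qed.

(** The set on which [m_smooth] gives smoothness of [trans a b]; on the
    rest of the image of a the map is junk. *)
Definition overlap a b : set 'rV[R]_n := ccoord M a @` (cdom M a `&` cdom M b).

Lemma overlap_open a b : open (overlap a b).
Proof.
apply: m_open_map => [|x []//].
by apply: openI; exact: m_open_dom.
Qed.

Lemma near_overlap a b x : cdom M a x -> cdom M b x ->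
  nbhs (ccoord M a x) (overlap a b).
Proof.
by move=> ax bx; apply: open_nbhs_nbhs; split; [exact: overlap_open|exists x].
Qed.

Lemma trans_diff a b x : cdom M a x -> cdom M b x ->
  differentiable (trans a b) (ccoord M a x).
Proof. by move=> ax bx; apply: smooth_diff (m_smooth a b) _; exists x. Qed.

Lemma row_jacobian k l (f : 'rV[R]_k -> 'rV[R]_l) y i : differentiable f y ->
  row i (jacobian f y) = 'D_(delta_mx 0 i) f y.
Proof. by move=> df; rewrite rowE; exact: esym (deriveEjacobian _ df). Qed.

Lemma jacobian_near k l (f g : 'rV[R]_k -> 'rV[R]_l) y :
  (\near y, f y = g y) -> differentiable f y -> jacobian f y = jacobian g y.
Proof.
move=> fg df; apply/row_matrixP => i.
have dg := near_differentiable fg df.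
have e1 := row_jacobian i df.
have e2 := row_jacobian i dg.
apply: (etrans e1); apply: (etrans _ (esym e2)).
exact: near_eq_derive.
Qed.

Lemma jacobian_comp j k l (f : 'rV[R]_j -> 'rV[R]_k) (g : 'rV[R]_k -> 'rV[R]_l) y :
  differentiable f y -> differentiable g (f y) ->
  jacobian (fun z => g (f z)) y = jacobian f y *m jacobian g (f y).
Proof.
move=> df dg; apply/row_matrixP => i.
have e1 := row_jacobian i (differentiable_comp df dg).
have e2 := derive_comp (delta_mx 0 i) df dg.
have e3 := deriveEjacobian ('D_(delta_mx 0 i) f y) dg.
have e4 := row_jacobian i df.
apply: (etrans e1); apply: (etrans e2); apply: (etrans e3).
by rewrite -e4 row_mul.
Qed.

(** Chain rule on the overlap of the three charts. *)
Lemma jacobian_trans_cocycle a b c x : cdom M a x -> cdom M b x -> cdom M c x ->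
  jacobian (trans a c) (ccoord M a x)
  = jacobian (trans a b) (ccoord M a x) *m jacobian (trans b c) (ccoord M b x).
Proof.
move=> ax bx cx; rewrite -(trans_ccoord b ax) -jacobian_comp; last first.
- by rewrite trans_ccoord //; exact: trans_diff.
- exact: trans_diff.
apply: jacobian_near; last exact: trans_diff.
by apply: filterS (near_overlap ax bx) => _ [x' [ax' bx'] <-]; rewrite !trans_ccoord.
Qed.

Lemma jacobian_trans_id a x : cdom M a x ->
  jacobian (trans a a) (ccoord M a x) = 1%:M.
Proof.
move=> ax; rewrite (@jacobian_near _ _ _ id); last exact: trans_diff.
  apply/row_matrixP => i; rewrite row_jacobian; last first.
    exact: (@ex_diff _ _ _ _ _ _ _ (is_diff_id _)).
  by rewrite derive_id rowE mulmx1.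
by apply: filterS (near_overlap ax ax) => _ [x' [ax' _] <-]; rewrite trans_ccoord.
Qed.

Lemma jacobian_transV a b x : cdom M a x -> cdom M b x ->
  jacobian (trans a b) (ccoord M a x) *m jacobian (trans b a) (ccoord M b x) = 1%:M.
Proof. by move=> ax bx; rewrite -jacobian_trans_cocycle // jacobian_trans_id. Qed.

End Transitions.

(** * The slit cotangent bundle *)

Section Slit.
Variables (R : realType) (n : nat) (M : manifold R n).
Implicit Types (a b c : chart M) (x : M) (p : 'rV[R]_n).

(** The momenta in one chart determine those in all others: by the
    transformation rule where the chart is defined, by normalization elsewhere. *)
Lemma cotangent_eq a (xi eta : cotangent M) : base xi = base eta ->
  cdom M a (base xi) -> momenta xi a = momenta eta a -> xi = eta.
Proof.
case: xi eta => [x m mt mj] [y l lt lj] /= e; case: y / e in lt lj * => ax ema.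
suff e : m = l.
  by case: l / e lt lj {ema} => lt lj; congr Cotangent; exact: Prop_irrelevance.
apply/funext => b; have [bx|nbx] := pselect (cdom M b x); last by rewrite mj // lj.
by rewrite (mt b a) // (lt b a) // ema.
Qed.

Section Covector.
Variables (a : chart M) (x : M) (p : 'rV[R]_n) (ax : cdom M a x).

(** The momenta p in the chart a, transported to all charts around x. *)
Definition covector_momenta b : 'rV[R]_n :=
  if `[< cdom M b x >] then p *m (jacobian (trans b a) (ccoord M b x))^T else 0.

(** The cocycle identity of the Jacobians. *)
Lemma covector_trans b c : cdom M b x -> cdom M c x ->
  covector_momenta b = covector_momenta c *m (jacobian (trans b c) (ccoord M b x))^T.
Proof.
move=> bx cx; rewrite /covector_momenta (asboolT bx) (asboolT cx).
by rewrite -mulmxA -trmx_mul -(jacobian_trans_cocycle bx cx ax).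
Qed.

Lemma covector_junk b : ~ cdom M b x -> covector_momenta b = 0.
Proof. by move=> bx; rewrite /covector_momenta asboolF. Qed.

Definition covector : cotangent M := Cotangent covector_trans covector_junk.

Lemma covectorE : momenta covector a = p.
Proof.
by rewrite /= /covector_momenta (asboolT ax) (jacobian_trans_id ax) trmx1 mulmx1.
Qed.

End Covector.

(** Momenta in different charts differ by a linear map, so they cannot vanish in
    one chart only. *)
Lemma slit_mom_neq0 a (q : slit M) : cdom (slit M) a q -> slit_mom a q != 0.
Proof.
case: q => xi /= xi0 axi; apply/eqP; rewrite /slit_mom /= => m0; apply: (xi0) => b.
have [bx|nbx] := pselect (cdom M b (base xi)); last exact: momenta_junk.
by rewrite (momenta_trans bx axi) m0 mul0mx.
Qed.

Lemma slit_ccoordE a (q : slit M) :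
  ccoord (slit M) a q = row_mx (ccoord M a (slit_base q)) (slit_mom a q).
Proof. by []. Qed.

Lemma slit_ccoordl a (q : slit M) :
  lsubmx (ccoord (slit M) a q) = ccoord M a (slit_base q).
Proof. by rewrite slit_ccoordE row_mxKl. Qed.

Lemma slit_ccoordr a (q : slit M) : rsubmx (ccoord (slit M) a q) = slit_mom a q.
Proof. by rewrite slit_ccoordE row_mxKr. Qed.

(** Every pair (x, p) with p nonzero comes from a point of the bundle, namely the
    [covector] with momenta p. *)
Lemma slit_imgE a : @img _ _ (slit M) a =
  [set y | @img _ _ M a (lsubmx y) /\ rsubmx y != 0].
Proof.
apply/seteqP; split=> y /=.
  move=> [q aq <-]; rewrite slit_ccoordl slit_ccoordr.
  by split; [exists (slit_base q)|exact: slit_mom_neq0].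
move=> [[x ax xy] y0].
have h : (~` @zero_section _ _ M) (covector (rsubmx y) ax).
  by move=> /(_ a); rewrite covectorE => /eqP; apply/negP.
exists (exist _ _ h) => //.
rewrite slit_ccoordE -[RHS]hsubmxK; congr row_mx; first exact: xy.
exact: covectorE.
Qed.

Lemma slit_regular : regular_charts (slit M).
Proof.
split=> a.
  move=> [q hq] [r hr]; rewrite !inE /= => aq ar /eq_row_mx[eb em].
  have e : q = r by apply: (@cotangent_eq a) => //; apply: m_inj eb; rewrite inE.
  by case: r / e hr ar eb em => hr _ _ _; congr exist; exact: Prop_irrelevance.
rewrite slit_imgE; apply: openI.
  apply: (open_comp (f := lsubmx)); last exact: (manifold_regular M).2.
  by move=> y _; exact: continuous_lsubmx.
apply: (open_comp (f := rsubmx) (D := [set p | p != 0])).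
  by move=> y _; exact: continuous_rsubmx.
rewrite (_ : mkset _ = ~` [set 0]); last by apply/seteqP; split=> p /eqP.
apply: closed_openC; apply: accessible_closed_set1.
exact: hausdorff_accessible (@norm_hausdorff _ _).
Qed.

End Slit.

(** * The complete lift in induced coordinates *)

Section Lift.
Variables (R : realType) (n : nat).
Implicit Types (x p : 'rV[R]_n) (y v : 'rV[R]_(n + n)).

Definition lift (xi : 'rV[R]_n -> 'rV[R]_n) y : 'rV[R]_(n + n) :=
  row_mx (xi (lsubmx y))
         (\row_i - dot (rsubmx y) ('D_(delta_mx 0 i) xi (lsubmx y))).

(** The components (p, 0) of the Liouville form, as a function of (x, p). *)
Definition theta y : 'rV[R]_(n + n) := row_mx (rsubmx y) 0.

(** The components of dp_i /\ dx^i, constant in induced coordinates. *)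
Definition Omega : 'M[R]_(n + n) := block_mx 0 (- 1%:M) 1%:M 0.

Lemma lsubmx_linear : linear (lsubmx : 'rV[R]_(n + n) -> 'rV[R]_n).
Proof. by move=> c u v; rewrite linearP. Qed.

Lemma rsubmx_linear : linear (rsubmx : 'rV[R]_(n + n) -> 'rV[R]_n).
Proof. by move=> c u v; rewrite linearP. Qed.

Lemma theta_linear : linear theta.
Proof.
by move=> c u v; rewrite /theta linearP /= scale_row_mx add_row_mx scaler0 addr0.
Qed.

Lemma derive_lsubmx_comp (W : normedModType R) (g : 'rV[R]_n -> W) y v :
  differentiable g (lsubmx y) ->
  'D_v (fun z => g (lsubmx z)) y = 'D_(lsubmx v) g (lsubmx y).
Proof.
move=> dg; rewrite (derive_comp v (@differentiable_lsubmx _ _ _ _ y) dg).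
by rewrite (derive_linear _ _ lsubmx_linear) //; exact: continuous_lsubmx.
Qed.

Lemma derive_rsubmx y v : 'D_v rsubmx y = rsubmx v :> 'rV[R]_n.
Proof. by rewrite (derive_linear _ _ rsubmx_linear) //; exact: continuous_rsubmx. Qed.

(** The components of the complete lift and its pairing with the Liouville form
    are, up to sign, p_j g^j (x) for suitable g; this is their common
    derivative. *)
Lemma derive_fiber_dot (g : 'rV[R]_n -> 'rV[R]_n) y v :
  differentiable g (lsubmx y) ->
  'D_v (fun z => dot (rsubmx z) (g (lsubmx z))) y =
  dot (rsubmx v) (g (lsubmx y)) + dot (rsubmx y) ('D_(lsubmx v) g (lsubmx y)).
Proof.
move=> dg.
rewrite (derive_dot v (@differentiable_rsubmx _ _ _ _ y)); last first.
  exact: differentiable_comp (@differentiable_lsubmx _ _ _ _ y) dg.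
by rewrite derive_rsubmx derive_lsubmx_comp.
Qed.

Lemma smooth_rsubmx (U : set 'rV[R]_(n + n)) : smooth_on U (rsubmx : _ -> 'rV[R]_n).
Proof.
case=> [|k]; first by move=> y _; exact: continuous_rsubmx.
split=> [y _|v]; first exact: differentiable_rsubmx.
have -> : (fun y => 'D_v rsubmx y) = fun=> rsubmx v.
  by apply/funext => y; exact: derive_rsubmx.
exact: Ck_cst.
Qed.

Section Smooth.
Variables (U : set 'rV[R]_n) (xi : 'rV[R]_n -> 'rV[R]_n).
Hypotheses (oU : open U) (sxi : smooth_on U xi).

Let UU : set 'rV[R]_(n + n) := lsubmx @^-1` U.

Lemma lsubmx_preimage_open : open UU.
Proof. by apply: open_comp oU => y _; exact: continuous_lsubmx. Qed.

Lemma smooth_lsubmx_comp (g : 'rV[R]_n -> 'rV[R]_n) : smooth_on U g ->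
  smooth_on UU (fun y => g (lsubmx y)).
Proof.
move=> sg k; apply: Ck_comp_linear (sg k) => //; first exact: lsubmx_linear.
exact: continuous_lsubmx.
Qed.

Lemma smooth_fiber_dot (g : 'rV[R]_n -> 'rV[R]_n) : smooth_on U g ->
  smooth_on UU (fun y => dot (rsubmx y) (g (lsubmx y))).
Proof.
move=> sg; apply: smooth_dot; first exact: lsubmx_preimage_open.
  exact: smooth_rsubmx.
exact: smooth_lsubmx_comp.
Qed.

Lemma smooth_lift : smooth_on UU (lift xi).
Proof.
move=> k; have oUU := lsubmx_preimage_open; apply: Ck_row => // A.
case: (split_ordP A) => i ->.
  have := Ck_coord i oUU (smooth_lsubmx_comp sxi k).
  by apply: Ck_ext => // y _; rewrite row_mxEl.
have h := smooth_fiber_dot (Ck_derive (delta_mx 0 i) sxi) k.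
have := CkM oUU (Ck_cst UU (-1 : R) k) h.
by apply: Ck_ext => // y _; rewrite row_mxEr mxE mulN1r.
Qed.

Lemma derive_lift y v : U (lsubmx y) ->
  'D_v (lift xi) y = row_mx ('D_(lsubmx v) xi (lsubmx y))
    (\row_i - (dot (rsubmx v) ('D_(delta_mx 0 i) xi (lsubmx y)) +
      dot (rsubmx y) ('D_(lsubmx v) (fun x => 'D_(delta_mx 0 i) xi x) (lsubmx y)))).
Proof.
move=> Uy; have dl : differentiable (lift xi) y by exact: smooth_diff smooth_lift _.
have dxi := smooth_diff sxi Uy.
apply/rowP => A; rewrite -(derive_coord v A dl); case: (split_ordP A) => i ->.
  rewrite row_mxEl -(derive_lsubmx_comp v dxi).
  have dl' := differentiable_comp (@differentiable_lsubmx _ _ _ _ y) dxi.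
  rewrite -(derive_coord v i dl').
  by congr (derive _ y v); apply/funext => z; rewrite row_mxEl.
have dd := smooth_diff (Ck_derive (delta_mx 0 i) sxi) Uy.
rewrite row_mxEr mxE -(derive_fiber_dot v dd) -deriveN; last first.
  have sd := smooth_fiber_dot (Ck_derive (delta_mx 0 i) sxi).
  by apply: diff_derivable; exact: smooth_diff sd Uy.
by congr (derive _ y v); apply/funext => z; rewrite row_mxEr mxE.
Qed.

End Smooth.
End Lift.

(** * Symmetries in induced coordinates *)

Section LocalSymmetry.
Variables (R : realType) (n : nat) (U : set 'rV[R]_n) (xi : 'rV[R]_n -> 'rV[R]_n).
Hypotheses (oU : open U) (sxi : smooth_on U xi).
Implicit Types (y : 'rV[R]_(n + n)).

Lemma derive_lift_x y i : U (lsubmx y) ->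
  'D_(delta_mx 0 (lshift n i)) (lift xi) y =
  row_mx ('D_(delta_mx 0 i) xi (lsubmx y))
    (\row_j - dot (rsubmx y)
       ('D_(delta_mx 0 i) (fun x => 'D_(delta_mx 0 j) xi x) (lsubmx y))).
Proof.
move=> Uy; rewrite (derive_lift oU sxi) // delta_mx_lshift row_mxKl row_mxKr.
by congr row_mx; apply/rowP => j; rewrite !mxE dot0l add0r.
Qed.

Lemma derive_lift_p y i : U (lsubmx y) ->
  'D_(delta_mx 0 (rshift n i)) (lift xi) y =
  row_mx 0 (\row_j - 'D_(delta_mx 0 j) xi (lsubmx y) 0 i).
Proof.
move=> Uy; rewrite (derive_lift oU sxi) // delta_mx_rshift row_mxKl row_mxKr derive0.
by congr row_mx; apply/rowP => j; rewrite !mxE dot_delta derive0 dot0r addr0.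
Qed.

(** The left-hand side is the Lie derivative of theta along the lift: theta is
    linear, so its derivative along a vector is its value at that vector. *)
Lemma lie_theta y : U (lsubmx y) ->
  theta (lift xi y) + \row_A dot (theta y) ('D_(delta_mx 0 A) (lift xi) y) = 0.
Proof.
move=> Uy; apply/rowP => A; rewrite mxE [X in _ + X]mxE [RHS]mxE /theta /lift.
case: (split_ordP A) => i ->.
  rewrite derive_lift_x // dot_row_mx dot0l addr0 row_mxEl row_mxKr mxE.
  by rewrite addNr.
by rewrite derive_lift_p // dot_row_mx dot0r dot0l row_mxEr [X in X + _]mxE !addr0.
Qed.

(** Row A holds the derivatives along the coordinate A, so that a derivative of
    the lift along v is v times this matrix. *)
Definition lift_jacobian y : 'M[R]_(n + n) :=
  \matrix_(A, B) 'D_(delta_mx 0 A) (lift xi) y 0 B.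

Lemma lift_jacobianE y : U (lsubmx y) -> lift_jacobian y =
  block_mx (\matrix_(i, j) 'D_(delta_mx 0 i) xi (lsubmx y) 0 j)
    (\matrix_(i, j) - dot (rsubmx y)
       ('D_(delta_mx 0 i) (fun x => 'D_(delta_mx 0 j) xi x) (lsubmx y)))
    0 (\matrix_(i, j) - 'D_(delta_mx 0 j) xi (lsubmx y) 0 i).
Proof.
move=> Uy; apply/matrixP => A B; rewrite mxE.
case: (split_ordP A) => i ->; case: (split_ordP B) => j ->.
- by rewrite derive_lift_x // row_mxEl block_mxEul mxE.
- by rewrite derive_lift_x // row_mxEr block_mxEur !mxE.
- by rewrite derive_lift_p // row_mxEl block_mxEdl !mxE.
- by rewrite derive_lift_p // row_mxEr block_mxEdr !mxE.
Qed.

(** The left-hand side is the Lie derivative of omega along the lift.  Its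
    off-diagonal blocks cancel identically; the upper left one is the
    antisymmetrized matrix of second derivatives of p_k xi^k. *)
Lemma lift_symplectic y : U (lsubmx y) ->
  lift_jacobian y *m Omega R n + Omega R n *m (lift_jacobian y)^T = 0.
Proof.
move=> Uy; rewrite lift_jacobianE // /Omega tr_block_mx !mulmx_block add_block_mx.
rewrite !(mul0mx, mulmx0, mulmx1, mul1mx, mulmxN, mulNmx, trmx0, add0r, addr0, oppr0).
rewrite -[RHS]block_mx0; congr block_mx.
- apply/matrixP => i j; rewrite !mxE; apply/eqP; rewrite subr_eq0; apply/eqP.
  have e := schwarz_row (delta_mx 0 j) (delta_mx 0 i) oU Uy sxi.
  exact: (congr1 (fun w => - dot (rsubmx y) w) e).
- by apply/matrixP => i j; rewrite !mxE opprK addNr.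
- by apply/matrixP => i j; rewrite !mxE addNr.
Qed.

Lemma Omega_square : Omega R n *m Omega R n = - 1%:M.
Proof.
rewrite /Omega mulmx_block scalar_mx_block opp_block_mx.
by rewrite !(mul0mx, mulmx0, mulmx1, mul1mx, add0r, addr0, oppr0).
Qed.

Variables (W : set 'rV[R]_(n + n)) (h : 'rV[R]_(n + n) -> R).
Hypotheses (oW : open W) (WU : forall y, W y -> U (lsubmx y)) (sh : smooth_on W h).

Lemma lift_diff y : U (lsubmx y) -> differentiable (lift xi) y.
Proof. by move=> Uy; exact: smooth_diff (smooth_lift oU sxi) _. Qed.

Hypothesis inv : forall y, W y -> dot (lift xi y) (gradient h y) = 0.

(** Invariance of h holds on an open set, so it can be differentiated along the
    coordinate A.  This gives the A-entry of grad h K^T plus, as second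
    derivatives of h commute, the A-entry of the left-hand side. *)
Lemma derive_lift_gradient y : W y ->
  'D_(lift xi y) (gradient h) y = - (gradient h y *m (lift_jacobian y)^T).
Proof.
move=> Wy; have Uy := WU Wy; have dg := smooth_diff (smooth_gradient oW sh) Wy.
have nearW : nbhs y W by exact: open_nbhs_nbhs.
apply/rowP => A; rewrite !mxE.
have eA : dot ('D_(delta_mx 0 A) (lift xi) y) (gradient h y) +
    dot (lift xi y) ('D_(delta_mx 0 A) (gradient h) y) = 0.
  rewrite -(derive_dot _ (lift_diff Uy) dg).
  rewrite -[RHS](derive_cst (0 : R) y (delta_mx 0 A)).
  by apply: near_eq_derive; apply: filterS nearW.
have -> : \sum_B gradient h y 0 B * (lift_jacobian y)^T B A =
    dot ('D_(delta_mx 0 A) (lift xi) y) (gradient h y).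
  by apply: eq_bigr => B _; rewrite !mxE mulrC.
move/eqP: eA; rewrite addrC addr_eq0 => /eqP <-.
rewrite (derive_dirE _ dg) summxE; apply: eq_bigr => B _; rewrite mxE; congr (_ * _).
have gE C : (fun z => gradient h z 0 C) = (fun z => 'D_(delta_mx 0 C) h z).
  by apply/funext => z; rewrite mxE.
have eA' := derive_coord (delta_mx 0 B) A dg.
have eB' := derive_coord (delta_mx 0 A) B dg.
rewrite gE in eA'; rewrite gE in eB'.
apply: (etrans (esym eA')); apply: (etrans _ eB').
exact: schwarz oW Wy (sh 2).
Qed.

Lemma derive_liftE y v : U (lsubmx y) -> 'D_v (lift xi) y = v *m lift_jacobian y.
Proof.
move=> Uy; rewrite (derive_dirE _ (lift_diff Uy)); apply/rowP => B.
by rewrite summxE mxE; apply: eq_bigr => A _; rewrite !mxE.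
Qed.

(** The left-hand side is the bracket of grad h Omega, the Hamiltonian field,
    with the lift.  It equals grad h (Omega K + K^T Omega), and the matrix in
    parentheses is that of [lift_symplectic] multiplied by Omega on both
    sides. *)
Lemma bracket_zero y : W y ->
  'D_(gradient h y *m Omega R n) (lift xi) y -
  'D_(lift xi y) (gradient h) y *m Omega R n = 0.
Proof.
move=> Wy; rewrite derive_liftE ?derive_lift_gradient //; last exact: WU.
rewrite mulNmx opprK -!mulmxA -mulmxDr.
set K := lift_jacobian y; set O := Omega R n.
have /(congr1 (fun A => O *m A *m O)) := lift_symplectic (WU Wy).
rewrite -/K -/O mulmx0 mul0mx mulmxDr mulmxDl.
rewrite -(mulmxA O (K *m O)) -(mulmxA K) (mulmxA O O) Omega_square.
rewrite mulmxN mulmx1 mulNmx mul1mx mulmxN mulNmx -opprD => /eqP.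
by rewrite oppr_eq0 => /eqP ->; rewrite mulmx0.
Qed.

(** Along the Hamiltonian field, p_i xi^i has derivative
    - h_x . xi + p . D_(h_p) xi, which is minus the derivative of h along the
    lift. *)
Lemma fiber_dot_conserved y : W y ->
  'D_(gradient h y *m Omega R n) (fun z => dot (rsubmx z) (xi (lsubmx z))) y = 0.
Proof.
move=> Wy; have Uy := WU Wy; have dxi := smooth_diff sxi Uy.
rewrite (derive_fiber_dot _ dxi).
have := inv Wy; set g := gradient h y; rewrite -(hsubmxK g) mul_row_block dot_row_mx.
rewrite !(mulmx0, mulmx1, mulmxN, add0r, addr0) row_mxKl row_mxKr dotNl.
move=> /eqP; rewrite addrC addr_eq0 => /eqP e.
rewrite dotC -e (dot_derive_dir _ _ dxi) -dotC.
have -> : \row_i - dot (rsubmx y) ('D_(delta_mx 0 i) xi (lsubmx y)) =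
   - \row_i dot (rsubmx y) ('D_(delta_mx 0 i) xi (lsubmx y)).
  by apply/rowP => i; rewrite !mxE.
by rewrite dotC dotNl dotC addNr.
Qed.

End LocalSymmetry.

(** * The complete lift under a change of coordinates *)

(** Here phi is a transition map, P gives the new momenta and xa, xb represent
    the same field in the old and new coordinates.  The left side is the
    derivative of the new momenta along the lift of xa, the right side the
    momentum part of the lift of xb, both multiplied by the i-th row of the
    Jacobian of phi.  Working with this product avoids the derivative of an
    inverse matrix. *)
Lemma lift_transform (R : realType) (n : nat) (O : set 'rV[R]_n)
    (phi xa xb : 'rV[R]_n -> 'rV[R]_n) (P : 'rV[R]_(n + n) -> 'rV[R]_n)
    (y : 'rV[R]_(n + n)) (x x' p : 'rV[R]_n) i :
  lsubmx y = x -> phi x = x' -> P y = p ->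
  open O -> O x -> smooth_on O phi ->
  differentiable xa x -> differentiable xb x' -> differentiable P y ->
  (\forall z \near x, xb (phi z) = 'D_(xa z) phi z) ->
  (forall k, \forall z \near y,
     dot (P z) ('D_(delta_mx 0 k) phi (lsubmx z)) = rsubmx z 0 k) ->
  dot ('D_(lift xa y) P y) ('D_(delta_mx 0 i) phi x) =
  dot (\row_k - dot p ('D_(delta_mx 0 k) xb x')) ('D_(delta_mx 0 i) phi x).
Proof.
move=> ex <- <- {x' p}; rewrite -{x}ex; set x := lsubmx y.
move=> oO Ox sphi dxa dxb dP Hxb HP.
have dphi := smooth_diff sphi Ox.
have nearO : nbhs x O by exact: open_nbhs_nbhs.
have ddphi k : differentiable (fun z => 'D_(delta_mx 0 k) phi z) x.
  exact: smooth_diff (Ck_derive (delta_mx 0 k) sphi) Ox.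
pose v := lift xa y; pose p := P y.
pose G z := \row_k dot p ('D_(delta_mx 0 k) phi z).
have dcst : differentiable (fun _ : 'rV[R]_n => p) x by exact: differentiable_cst.
have dGk k : differentiable (fun z => dot p ('D_(delta_mx 0 k) phi z)) x.
  exact: dot_diff dcst (ddphi k).
have Gk k : (fun z => G z 0 k) = (fun z => dot p ('D_(delta_mx 0 k) phi z)).
  by apply/funext => z; rewrite mxE.
have dG : differentiable G x by apply: row_diff => k; rewrite Gk.
have Gx : G x = rsubmx y.
  by apply/rowP => k; rewrite mxE; exact: (nbhs_singleton (HP k)).
(* The identity P_j d_i phi^j = p_i, differentiated along the lift. *)
have E1 : dot ('D_v P y) ('D_(delta_mx 0 i) phi x) +
    dot p ('D_(xa x) (fun z => 'D_(delta_mx 0 i) phi z) x) =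
    - dot (rsubmx y) ('D_(delta_mx 0 i) xa x).
  have dl := differentiable_comp (@differentiable_lsubmx _ _ _ _ y) (ddphi i).
  have e1 := derive_dot v dP dl.
  have e2 := derive_lsubmx_comp v (ddphi i).
  have e3 := near_eq_derive v (HP i).
  have e4 := derive_coord v i (@differentiable_rsubmx R _ n n y).
  rewrite derive_rsubmx row_mxKr mxE in e4.
  rewrite row_mxKl in e2.
  by rewrite -e2 -e4; exact: (etrans (esym e1) e3).
(* The identity xb (phi z) = d phi (xa z), differentiated along the i-th
   coordinate and paired with the fixed new momenta p. *)
have E2 : dot ('D_(delta_mx 0 i) phi x) (\row_k dot p ('D_(delta_mx 0 k) xb (phi x))) =
    dot ('D_(delta_mx 0 i) xa x) (rsubmx y) +
    dot p ('D_(xa x) (fun z => 'D_(delta_mx 0 i) phi z) x).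
  rewrite -(dot_derive_dir p _ dxb) -(derive_comp _ dphi dxb) -Gx.
  have dxbphi := differentiable_comp dphi dxb.
  have e1 := derive_dot (delta_mx 0 i) dcst dxbphi.
  rewrite derive_cst dot0l add0r in e1.
  have e2 := derive_dot (delta_mx 0 i) dxa dG.
  have e3 : \forall z \near x, dot p ((xb \o phi) z) = dot (xa z) (G z).
    apply: filterS2 Hxb nearO => z /= -> Oz.
    exact: dot_derive_dir (smooth_diff sphi Oz).
  have e4 := near_eq_derive (delta_mx 0 i) e3.
  apply: (etrans (esym e1)); apply: (etrans e4); apply: (etrans e2).
  congr (_ + _); rewrite (dot_derive_dir _ _ (ddphi i)); congr dot.
  apply/rowP => k; rewrite mxE.
  apply: (etrans (esym (derive_coord _ k dG))); rewrite Gk.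
  have e5 := derive_dot (delta_mx 0 i) dcst (ddphi k).
  rewrite derive_cst dot0l add0r in e5.
  apply: (etrans e5).
  exact: (congr1 (dot p) (schwarz_row _ _ oO Ox sphi)).
have -> : \row_k - dot p ('D_(delta_mx 0 k) xb (phi x)) =
    - \row_k dot p ('D_(delta_mx 0 k) xb (phi x)).
  by apply/rowP => k; rewrite !mxE.
rewrite dotNl (dotC (\row_k _)) E2 opprD (dotC _ (rsubmx y)) -E1.
by rewrite addrK.
Qed.

Section GlobalLift.
Variables (R : realType) (n : nat) (M : manifold R n).
Variable X : components M 'rV[R]_n.
Hypothesis vX : vector_field X.
Implicit Types (a b : chart M) (q : slit M).

Notation chart_rep a := (rep (m := n) (N := M) a (X a)).

Lemma chart_repE a (x : M) : cdom M a x -> chart_rep a (ccoord M a x) = X a x.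
Proof. exact: (rep_ccoord (manifold_regular M)). Qed.

Lemma complete_liftE a q : cdom (slit M) a q ->
  complete_lift X a q = lift (chart_rep a) (ccoord (slit M) a q).
Proof.
by move=> aq; rewrite /lift slit_ccoordl slit_ccoordr chart_repE.
Qed.

Lemma liouvilleE a q : @liouville R n M a q = theta (ccoord (slit M) a q).
Proof. by rewrite /theta slit_ccoordr. Qed.

Lemma chart_rep_smooth a : smooth_on (@img _ _ M a) (chart_rep a).
Proof. exact: vX.2. Qed.

Lemma img_open a : open (@img _ _ M a).
Proof. exact: (manifold_regular M).2. Qed.

Lemma img_ccoord a (x : M) : cdom M a x -> @img _ _ M a (ccoord M a x).
Proof. by move=> ax; exists x. Qed.

Lemma slit_img_base a y : @img _ _ (slit M) a y -> @img _ _ M a (lsubmx y).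
Proof. by rewrite slit_imgE => -[]. Qed.

Lemma complete_lift_smooth a :
  smooth_on (@img _ _ (slit M) a) (rep (N := slit M) a (complete_lift X a)).
Proof.
have sl := smooth_lift (@img_open a) (chart_rep_smooth a).
apply: (smooth_rep (slit_regular M) (@complete_liftE a)).
exact: smooth_onS (@slit_img_base a) sl.
Qed.

Lemma slit_mom_trans a b q : cdom (slit M) a q -> cdom (slit M) b q ->
  slit_mom a q = slit_mom b q *m (jacobian (trans a b) (ccoord M a (slit_base q)))^T.
Proof. exact: momenta_trans. Qed.

Lemma slit_mom_dot a b q i : cdom (slit M) a q -> cdom (slit M) b q ->
  slit_mom a q 0 i =
  dot (slit_mom b q) ('D_(delta_mx 0 i) (trans a b) (ccoord M a (slit_base q))).
Proof.
move=> aq bq; rewrite (slit_mom_trans aq bq).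
by rewrite mulmx_tr_coord (row_jacobian i (trans_diff aq bq)).
Qed.

(** The new momenta as a function of the old coordinates, in the form which shows
    that they are differentiable: the inverse transition map is smooth. *)
Definition momentum_trans a b (y : 'rV[R]_(n + n)) : 'rV[R]_n :=
  \row_i dot (rsubmx y) ('D_(delta_mx 0 i) (trans b a) (trans a b (lsubmx y))).

Lemma momentum_transE a b q : cdom (slit M) a q -> cdom (slit M) b q ->
  momentum_trans a b (ccoord (slit M) a q) = slit_mom b q.
Proof.
move=> aq bq; apply/rowP => i; rewrite mxE slit_ccoordl slit_ccoordr.
by rewrite (trans_ccoord b aq) -slit_mom_dot.
Qed.

Lemma near_slit_overlap a b q : cdom (slit M) a q -> cdom (slit M) b q ->
  nbhs (ccoord (slit M) a q)
    [set y | exists q', [/\ cdom (slit M) a q', cdom (slit M) b q'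
                          & y = ccoord (slit M) a q']].
Proof.
move=> aq bq.
have nW : nbhs (ccoord (slit M) a q) (@img _ _ (slit M) a).
  by apply: open_nbhs_nbhs; split; [exact: (slit_regular M).2|exists q].
have nO : nbhs (ccoord (slit M) a q) (lsubmx @^-1` overlap a b).
  apply: open_nbhs_nbhs; split.
    exact: (lsubmx_preimage_open (@overlap_open R n M a b)).
  by rewrite /= slit_ccoordl; exists (slit_base q).
apply: filterS2 nW nO => _ [q' aq' <-] /= [x [ax bx]].
rewrite slit_ccoordl => e; exists q'; split => //.
have ex : x = slit_base q' by apply: (m_inj (a := a)) e; rewrite inE.
by move: bx; rewrite ex.
Qed.

Lemma momentum_trans_diff a b q : cdom (slit M) a q -> cdom (slit M) b q ->
  differentiable (momentum_trans a b) (ccoord (slit M) a q).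
Proof.
move=> aq bq; set y := ccoord (slit M) a q; apply: row_diff => i.
have dtr : differentiable (trans a b) (lsubmx y).
  by rewrite /y slit_ccoordl; exact: trans_diff.
have dtr' : differentiable (fun x => 'D_(delta_mx 0 i) (trans b a) x)
    (trans a b (lsubmx y)).
  rewrite /y slit_ccoordl (trans_ccoord b aq).
  by apply: smooth_diff (Ck_derive _ (m_smooth b a)) _; exists (slit_base q).
have -> : (fun y => momentum_trans a b y 0 i) = (fun y =>
    dot (rsubmx y) ('D_(delta_mx 0 i) (trans b a) (trans a b (lsubmx y)))).
  by apply/funext => z; rewrite mxE.
have dl := differentiable_comp (@differentiable_lsubmx R _ n n y) dtr.
exact: dot_diff (@differentiable_rsubmx R _ n n y) (differentiable_comp dl dtr').
Qed.

(** The base components transform like those of X.  The momentum components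
    agree by [lift_transform], because the Jacobian of the transition map is
    invertible. *)
Lemma complete_lift_trans a b q : cdom (slit M) a q -> cdom (slit M) b q ->
  complete_lift X b q =
  complete_lift X a q *m jacobian (@trans _ _ (slit M) a b) (ccoord (slit M) a q).
Proof.
move=> aq bq; set y := ccoord (slit M) a q; set x := ccoord M a (slit_base q).
have yx : lsubmx y = x by exact: slit_ccoordl.
have dphi : differentiable (trans a b) (lsubmx y).
  by rewrite yx; exact: trans_diff.
have dphil := differentiable_comp (@differentiable_lsubmx R _ n n y) dphi.
have dP := momentum_trans_diff aq bq.
(* T is the coordinate change of the bundle, in a form that can be differentiated. *)
pose T z := row_mx (trans a b (lsubmx z)) (momentum_trans a b z).
have nT : \forall z \near y, T z = @trans _ _ (slit M) a b z.
  apply: filterS (near_slit_overlap aq bq) => _ [q' [aq' bq' ->]].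
  rewrite /T (momentum_transE aq' bq') slit_ccoordl (trans_ccoord b aq').
  by rewrite /trans (rep_ccoord (slit_regular M)).
have dT : differentiable T y by exact: row_mx_diff dphil dP.
rewrite -(jacobian_near nT dT).
apply: (etrans _ (deriveEjacobian _ dT)).
apply: (etrans _ (esym (derive_row_mx _ dphil dP))).
have vE := complete_liftE aq; rewrite -/y in vE.
have e1 := derive_lsubmx_comp (complete_lift X a q) dphi.
rewrite [complete_lift X b q](complete_liftE bq) /lift.
rewrite slit_ccoordl slit_ccoordr.
congr row_mx.
  apply: (etrans _ (esym e1)); rewrite (chart_repE bq).
  have -> : lsubmx (complete_lift X a q) = X a (slit_base q) by exact: row_mxKl.
  rewrite (vX.1 _ _ _ aq bq) yx.
  exact: esym (deriveEjacobian _ (trans_diff aq bq)).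
(* Both rows of momentum components are compared after multiplication by the
   Jacobian of the transition map. *)
rewrite vE; set W := \row_i _; set D := 'D_ _ _ _.
have nx : nbhs x (overlap a b) by exact: near_overlap aq bq.
have ox : overlap a b x := nbhs_singleton nx.
have H i : dot D ('D_(delta_mx 0 i) (trans a b) x) =
    dot W ('D_(delta_mx 0 i) (trans a b) x).
  have xb : trans a b x = ccoord M b (slit_base q) by exact: trans_ccoord.
  have pb : momentum_trans a b y = slit_mom b q by exact: momentum_transE.
  apply: (@lift_transform R n (overlap a b) (trans a b) (chart_rep a) (chart_rep b)
    (momentum_trans a b) y x _ _ i yx xb pb (@overlap_open R n M a b) ox).
  - exact: m_smooth.
  - exact: smooth_diff (chart_rep_smooth a) (img_ccoord aq).
  - exact: smooth_diff (chart_rep_smooth b) (img_ccoord bq).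
  - exact: dP.
  - apply: filterS nx => _ [x' [ax' bx'] <-].
    rewrite (trans_ccoord b ax') (chart_repE ax') (chart_repE bx').
    rewrite (vX.1 _ _ _ ax' bx').
    exact: esym (deriveEjacobian _ (trans_diff ax' bx')).
  - move=> k; apply: filterS (near_slit_overlap aq bq) => _ [q' [aq' bq' ->]].
    by rewrite (momentum_transE aq' bq') slit_ccoordl slit_ccoordr -slit_mom_dot.
have HJ : D *m (jacobian (trans a b) x)^T = W *m (jacobian (trans a b) x)^T.
  apply/rowP => i; rewrite !mulmx_tr_coord (row_jacobian i (trans_diff aq bq)).
  exact: H.
have := congr1 (mulmxr (jacobian (trans b a) (ccoord M b (slit_base q)))^T) HJ.
by rewrite /= -!mulmxA -trmx_mul (jacobian_transV bq aq) trmx1 !mulmx1.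
Qed.

Lemma complete_lift_vector_field : vector_field (complete_lift X).
Proof.
by split; [move=> a b q; exact: complete_lift_trans|exact: complete_lift_smooth].
Qed.

(** Momenta transform by the transposed inverse of the matrix that transforms
    vectors, so the pairing is the same in all charts. *)
Lemma pairing_liouville a q : cdom (slit M) a q ->
  pairing (@liouville R n M) (complete_lift X) q =
  dot (slit_mom a q) (X a (slit_base q)).
Proof.
move=> aq; have pE b : \sum_A @liouville R n M b q 0 A * complete_lift X b q 0 A =
    dot (slit_mom b q) (X b (slit_base q)).
  by rewrite -/(dot _ _) dot_row_mx dot0l addr0.
apply: xget_unique; first by exists a => //; rewrite pE.
move=> _ [b bq ->]; rewrite pE (slit_mom_trans aq bq) (vX.1 a b) //.
by rewrite dot_mulmxr.
Qed.

End GlobalLift.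

(** * Lie derivatives on the slit cotangent bundle *)

Lemma lie_funE (R : realType) (m : nat) (N : charted R m)
    (Y : components N 'rV[R]_m) (f : N -> R) a q :
  lie_fun Y f a q = dot (Y a q) (gradient (rep a f) (ccoord N a q)).
Proof. by apply: eq_bigr => A _; rewrite mxE. Qed.

Section Conclusion.
Variables (R : realType) (n : nat) (M : manifold R n).
Implicit Types (a b : chart M) (q : slit M).

Local Notation Th := (@liouville R n M).

Lemma pdc_liouville A a q : cdom (slit M) a q ->
  pdc (N := slit M) A a (Th a) q = theta (delta_mx 0 A).
Proof.
move=> aq; have e := pdc_local (slit_regular M) A aq (fun q' _ => liouvilleE a q').
apply: (etrans e); apply: derive_linear; first exact: theta_linear.
exact: rV_linear_continuous (@theta_linear R n).
Qed.

Lemma symplecticE a q : cdom (slit M) a q -> @symplectic R n M a q = Omega R n.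
Proof.
move=> aq; apply/matrixP => A B; rewrite mxE !pdc_liouville // /theta /Omega.
case: (split_ordP A) => i ->; case: (split_ordP B) => j ->.
- rewrite !row_mxEl block_mxEul delta_mx_lshift row_mxKr delta_mx_lshift row_mxKr.
  by rewrite !mxE subr0.
- rewrite row_mxEr row_mxEl block_mxEur delta_mx_rshift row_mxKr !mxE eqxx sub0r.
  by rewrite eq_sym.
- rewrite row_mxEl row_mxEr block_mxEdl delta_mx_rshift row_mxKr !mxE eqxx subr0.
  by rewrite eq_sym.
- by rewrite !row_mxEr block_mxEdr !mxE subr0.
Qed.

Variables (H : cotangent_bundle M -> R) (X : components M 'rV[R]_n).
Hypotheses (sH : smooth_fun (slit_restrict H)) (iX : invariant_field H X).

Let vX : vector_field X := iX.1.
Let xi a := rep (m := n) (N := M) a (X a).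
Let h a := rep (N := slit M) a (slit_restrict H).
Let W a := @img R _ (slit M) a.

Lemma slit_img_ccoord a q : cdom (slit M) a q -> W a (ccoord (slit M) a q).
Proof. by move=> aq; exists q. Qed.

Lemma invariance a y : W a y -> dot (lift (xi a) y) (gradient (h a) y) = 0.
Proof.
move=> [q aq <-]; have := iX.2 a q aq.
by rewrite lie_funE (complete_liftE X aq).
Qed.

(** Omega rotates the covector (h_x, h_p) into the vector (h_p, - h_x). *)
Lemma hamiltonianE a q :
  hamiltonian_field H a q = gradient (h a) (ccoord (slit M) a q) *m Omega R n.
Proof.
rewrite -[X in X *m _]hsubmxK mul_row_block.
rewrite !(mulmx0, mulmx1, mulmxN, add0r, addr0).
by congr row_mx; apply/rowP => i; rewrite !mxE.
Qed.

Lemma lie_liouville a q : cdom (slit M) a q -> lie_form1 (complete_lift X) Th a q = 0.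
Proof.
move=> aq; set y := ccoord (slit M) a q.
have Uy : @img _ _ M a (lsubmx y) by exact: slit_img_base (slit_img_ccoord aq).
have E := lie_theta (@img_open R n M a) (chart_rep_smooth vX a) Uy.
rewrite -[RHS]E; apply/rowP => A; rewrite mxE [RHS]mxE.
under eq_bigr => B _.
  rewrite (pdc_liouville B aq).
  rewrite (pdc_local (slit_regular M) A aq (@complete_liftE R n M X a)).
  rewrite (complete_liftE X aq) liouvilleE -/y.
  over.
rewrite big_split /=; congr (_ + _); last by rewrite mxE.
have lt := @theta_linear R n.
have e := derive_linear y (lift (xi a) y) lt (rV_linear_continuous lt).
have dt := @ex_diff _ _ _ _ _ _ _ (linear_diff y lt (rV_linear_continuous lt)).
rewrite -[in RHS]e (derive_dirE _ dt) summxE; apply: eq_bigr => B _.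
by rewrite [RHS]mxE (derive_linear y _ lt (rV_linear_continuous lt)).
Qed.

Lemma lie_symplectic a q : cdom (slit M) a q ->
  lie_form2 (complete_lift X) (@symplectic R n M) a q = 0.
Proof.
move=> aq; set y := ccoord (slit M) a q.
have Uy : @img _ _ M a (lsubmx y) by exact: slit_img_base (slit_img_ccoord aq).
have E := lift_symplectic (@img_open R n M a) (chart_rep_smooth vX a) Uy.
rewrite -[RHS]E; apply/matrixP => A B; rewrite mxE [RHS]mxE [X in _ = X + _]mxE.
rewrite [X in _ = _ + X]mxE -big_split; apply: eq_bigr => C _ /=.
have wE (r : slit M) : cdom (slit M) a r -> @symplectic R n M a r A B = Omega R n A B.
  by move=> ar; rewrite symplecticE.
rewrite (pdc_local (F := fun=> Omega R n A B) (slit_regular M) C aq wE).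
rewrite derive_cst mulr0 add0r.
rewrite !(pdc_local (slit_regular M) _ aq (@complete_liftE R n M X a)).
rewrite symplecticE // -/y.
by rewrite [lift_jacobian _ _ A C]mxE [_^T C B]mxE [lift_jacobian _ _ B C]mxE mulrC.
Qed.

Lemma hamiltonian_bracket a q : cdom (slit M) a q ->
  lie_bracket (hamiltonian_field H) (complete_lift X) a q = 0.
Proof.
move=> aq; set y := ccoord (slit M) a q.
have Wy : W a y := slit_img_ccoord aq.
have oW := (slit_regular M).2 a.
have E := bracket_zero (@img_open R n M a) (chart_rep_smooth vX a) oW
  (@slit_img_base R n M a) (sH a) (@invariance a) Wy.
have dg := smooth_diff (smooth_gradient oW (sH a)) Wy.
have dl := lift_diff (@img_open R n M a) (chart_rep_smooth vX a) (slit_img_base Wy).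
have dgO : differentiable (fun z => gradient (h a) z *m Omega R n) y.
  exact: mulmxr_diff.
rewrite -(derive_mulmxr _ _ dg) in E.
rewrite -[RHS]E; apply/rowP => A; rewrite mxE [RHS]mxE [X in _ = _ + X]mxE.
rewrite (derive_dirE _ dgO) (derive_dirE _ dl) !summxE -sumrB; apply: eq_bigr => B _.
rewrite (pdc_local (slit_regular M) _ aq (@complete_liftE R n M X a)).
rewrite (pdc_local (F := fun z => gradient (h a) z *m Omega R n) (slit_regular M) _ aq
  (fun q' _ => hamiltonianE a q')).
rewrite hamiltonianE (complete_liftE X aq) -/y.
by rewrite [X in _ = X - _]mxE [X in _ = _ - X]mxE.
Qed.

Lemma pairingE a q : cdom (slit M) a q ->
  pairing Th (complete_lift X) q =
  dot (rsubmx (ccoord (slit M) a q)) (xi a (lsubmx (ccoord (slit M) a q))).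
Proof.
move=> aq; rewrite (pairing_liouville vX aq) slit_ccoordr slit_ccoordl.
by rewrite /xi (chart_repE _ aq).
Qed.

Lemma pairing_conserved : conservation_law H (pairing Th (complete_lift X)).
Proof.
split=> a.
  apply: (smooth_rep (slit_regular M) (@pairingE a)).
  exact: smooth_onS (@slit_img_base R n M a)
    (smooth_fiber_dot (@img_open R n M a) (chart_rep_smooth vX a)).
move=> q aq; rewrite lie_funE hamiltonianE; set y := ccoord (slit M) a q.
have Wy : W a y := slit_img_ccoord aq.
have E := fiber_dot_conserved (chart_rep_smooth vX a) (@slit_img_base R n M a)
  (@invariance a) Wy.
have df := smooth_diff (smooth_fiber_dot (@img_open R n M a) (chart_rep_smooth vX a))
  (slit_img_base Wy).
rewrite -[RHS]E (derive_dirE _ df); apply: eq_bigr => A _; congr (_ * _).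
rewrite mxE; exact: (pdc_local
  (F := fun z => dot (rsubmx z) (xi a (lsubmx z))) (slit_regular M) A aq (@pairingE a)).
Qed.

End Conclusion.

Theorem theorem4 (R : realType) (n : nat) (M : manifold R n)
    (H : cotangent_bundle M -> R) (X : components M 'rV[R]_n) :
  hamilton_space H ->
  invariant_field H X ->
  [/\ exact_noether_symmetry H (complete_lift X),
      natural_symmetry H X,
      (forall a (q : slit M), cdom (slit M) a q ->
         pairing (@liouville R n M) (complete_lift X) q
         = \sum_(i < n) slit_mom a q 0 i * X a (slit_base q) 0 i)
    & conservation_law H (pairing (@liouville R n M) (complete_lift X))].
Proof.
move=> [sH _ _ _] iX; have vX := iX.1; split.
- split; first split.
  + exact: complete_lift_vector_field.
  + by move=> a q aq; exact: (@lie_symplectic R n M H X iX a q aq).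
  + exact: iX.2.
  (* The Lie derivative of the Liouville form is zero, hence exact. *)
  + exists (fun=> 0) => a.
      apply: (smooth_rep (F := fun=> 0) (slit_regular M)) => // k; exact: Ck_cst.
    move=> q aq; rewrite (@lie_liouville R n M H X iX a q aq).
    apply/rowP => A; rewrite !mxE.
    by rewrite (pdc_local (F := fun=> 0) (slit_regular M) A aq) // derive_cst.
- by split=> // a q aq; exact: (@hamiltonian_bracket R n M H X sH iX a q aq).
- by move=> a q aq; exact: (@pairing_liouville R n M X vX a q aq).
- exact: pairing_conserved.
Qed.
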